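(* Let $A\subseteq\mathbb{N}$ be an infinite set of natural numbers and let $a(0)<a(1)<\cdots$ be all the elements of $A$. Suppose that $\sup_n|a(n+1)-a(n)|\le L$ for some $L>0$. For every irrational $x$, denote $a_x(n):=a(n)x\bmod 1$; then $$\mathrm{AE}(1_A)\le \mathrm{AE}(a_x)\le L\cdot\mathrm{AE}(1_A),$$ where $1_A:\mathbb{N}\to\{0,1\}$ is the characteristic function of $A$. In particular, $1_A$ has entropy zero if and only if $(a(n))_{n\in\mathbb{N}}$ is centered and has dual entropy zero.
   Context: $\mathbb{N}=\{0,1,2,\dots\}$. Entropy of a sequence: let $x=(x(n))_{n\in\mathbb{N}}$ be a sequence in $K=\mathbb{R}/\mathbb{Z}$, or a bounded sequence in $K=\mathbb{C}$. Let $X_0$ be the closure of $\{x(n):n\in\mathbb{N}\}$ in $K$ (a compact space), and let $X_x$ be the closure of $\{(x(m),x(m+1),x(m+2),\dots): m\in\mathbb{N}\}$ in $X_0^{\mathbb{N}}$ with the product topology. The shift $\sigma:(\omega_0,\omega_1,\dots)\mapsto(\omega_1,\omega_2,\dots)$ maps $X_x$ continuously to itself. The (anqie) entropy of $x$, denoted $\mathrm{AE}(x)\in[0,\infty]$, is the topological entropy of $(X_x,\sigma)$: the supremum over open covers $\mathcal{U}$ of $X_x$ of $\lim_{n}\frac1n\log\mathcal{N}(\mathcal{U}\vee\sigma^{-1}\mathcal{U}\vee\cdots\vee\sigma^{-n+1}\mathcal{U})$, where $\mathcal{N}(\mathcal{W})$ is the minimal cardinality of a subcover of $\mathcal{W}$.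 Here $a_x$ is a sequence in $\mathbb{R}/\mathbb{Z}$ and $1_A$ is a bounded sequence in $\mathbb{C}$. Dual entropy: let $(a(n))_{n\in\mathbb{N}}$ be a sequence of integers. If there is $\lambda\in[0,\infty]$ such that the sequence $a(n)x\bmod 1$ has entropy $\lambda$ for Lebesgue-almost all real $x$, then $(a(n))$ is called centered and $\lambda$ is its dual entropy. *)

(* Defs.v *)
From HB Require Import structures.
From mathcomp Require Import all_boot all_order all_algebra archimedean.
From mathcomp Require Import complex.
From mathcomp Require Import all_classical all_reals all_analysis.

Set Implicit Arguments.
Unset Strict Implicit.
Unset Printing Implicit Defensive.
Import Order.TTheory GRing.Theory Num.Theory.
Import numFieldNormedType.Exports.

Local Open Scope classical_set_scope.
Local Open Scope card_scope.
Local Open Scope ring_scope.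
Local Open Scope quotient_scope.

Section Circle.
Context {R : realType}.

Definition eqmod1 (x y : R) : bool := x - y \is a Num.int.

Lemma eqmod1_refl : reflexive eqmod1.
Proof. by move=> x; rewrite /eqmod1 subrr rpred0. Qed.

Lemma eqmod1_sym : symmetric eqmod1.
Proof. by move=> x y; rewrite /eqmod1 -opprB rpredN. Qed.

Lemma eqmod1_trans : transitive eqmod1.
Proof.
by move=> y x z xy yz; rewrite /eqmod1 -(subrKA y); exact: rpredD.
Qed.

Canonical eqmod1_equiv := EquivRel eqmod1 eqmod1_refl eqmod1_sym eqmod1_trans.
End Circle.

(* R/Z with the quotient topology. *)
Definition circle (R : realType) : topologicalType :=
  quotient_topology {eq_quot (@eqmod1 R)}.

Definition mod1 (R : realType) (x : R) : circle R :=
  \pi_(quotient_topology {eq_quot (@eqmod1 R)}) x.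

(* The system is a subset X of an ambient space T that f maps to itself.
   Covers of X are sets of subsets of X, open in the topology induced by T. *)
Section TopologicalEntropy.
Context {R : realType} {T : topologicalType}.
Implicit Types (X : set T) (f : T -> T) (U V W : set (set T)).

Definition rel_open X (u : set T) : Prop :=
  exists2 O : set T, open O & u = X `&` O.

Definition open_cover X U : Prop :=
  U `<=` rel_open X /\ X `<=` \bigcup_(u in U) u.

Definition cover_join U V : set (set T) :=
  [set w | exists u v, [/\ U u, V v & w = u `&` v]].

Definition cover_preimage X f U : set (set T) :=
  [set X `&` f @^-1` u | u in U].

(* The trivial cover [set X] is neutral for joins of covers by subsets of X. *)
Definition iter_join X f U (n : nat) : set (set T) :=
  \big[cover_join/[set X]]_(i < n) cover_preimage X (iter i f) U.

(* +oo if there is no finite subcover. *)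
Definition min_subcover X W : \bar R :=
  ereal_inf [set (n%:R)%:E | n in
    [set n : nat | exists V,
       [/\ V `<=` W, X `<=` \bigcup_(v in V) v & V #= `I_n]]].

Definition cover_entropy X f U : \bar R :=
  limn (fun n : nat =>
    ((n%:R^-1)%:E * lne (min_subcover X (iter_join X f U n)))%E).

Definition topological_entropy X f : \bar R :=
  ereal_sup [set cover_entropy X f U | U in open_cover X].

End TopologicalEntropy.

Section AnqieEntropy.
Context {R : realType} {K : topologicalType}.

(* The shift on K^N, with the product topology. *)
Definition shift (w : {ptws nat -> K}) : {ptws nat -> K} := fun n => w n.+1.

Definition value_closure (x : nat -> K) : set K := closure (range x).

(* The closure is taken in the subspace value_closure x ^ N of K^N. *)
Definition orbit_closure (x : nat -> K) : set {ptws nat -> K} :=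
  [set w : {ptws nat -> K} | forall n, value_closure x (w n)] `&`
  closure (range (fun m : nat => (fun n => x (m + n)%N) : {ptws nat -> K})).

Definition AE (x : nat -> K) : \bar R :=
  topological_entropy (orbit_closure x) shift.

End AnqieEntropy.
Arguments AE R {K} x.

(* The complex numbers over R, with the topology given by the modulus. *)
Definition Cplx (R : realType) : numFieldType := R[i].

Section DualEntropy.
Context {R : realType}.

Definition dilation_mod1 (a : nat -> int) (x : R) : nat -> circle R :=
  fun n => mod1 ((a n)%:~R * x).

Definition has_dual_entropy (a : nat -> int) (lambda : \bar R) : Prop :=
  (0 <= lambda)%E /\
  {ae lebesgue_measure, forall x : R, AE R (dilation_mod1 a x) = lambda}.

Definition centered (a : nat -> int) : Prop :=
  exists lambda : \bar R, has_dual_entropy a lambda.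

End DualEntropy.
Arguments centered R a : clear implicits.
Arguments has_dual_entropy R a lambda : clear implicits.

(* Main.v *)
From HB Require Import structures.
From mathcomp Require Import all_boot all_order all_algebra.
From mathcomp Require Import archimedean complex ring lra zify.
From mathcomp Require Import all_classical all_reals all_analysis.
Require Import Defs.
Set Implicit Arguments.
Unset Strict Implicit.
Unset Printing Implicit Defensive.
Import Order.TTheory GRing.Theory Num.Theory.
Import numFieldNormedType.Exports.
Local Open Scope classical_set_scope.
Local Open Scope ring_scope.

(** Let [p_s n] be the number of words of length [n] in a sequence [s] over a
    finite alphabet. For [y = a_x] with [s] the sequence of gaps
    [a (n + 1) - a n], and for [y = 1_A] with [s = 1_A] itself:
    - nearby points of the orbit closure of [y] have the same current letter
      (for [a_x]: the rotations by [x], ..., [l x] are separated in R/Z because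
      [x] is irrational), so that some open cover has at least [p_s n] elements
      in every subcover of its [n]-th join;
    - points of the orbit with the same word of length [n], and the same one
      among finitely many colours, stay close for [n] steps (for [a_x] a gap
      word fixes the orbit segment up to a rotation, and the colour is an arc
      containing the initial point), so that, by a Lebesgue number argument,
      the [n]-th join of every open cover has a subcover with at most
      [C * p_s n] elements.
    The two entropies are thus compared through the two word counts: a word of
    [1_A] is determined by a gap word of the same length and a bounded phase,
    and a gap word of length [n] by a word of [1_A] of length [l n + 1].
    Subadditivity (Fekete) makes every limit in the definition of entropy
    exist, which matters because [limn] is a junk value otherwise. *)

(** * Covering numbers *)

Section Covers.
Context {R : realType} {T : topologicalType}.
Implicit Types (X : set T) (f : T -> T) (U V W : set (set T)).

(** Stated for an arbitrary family [h] because peeling off the first factor of the join shifts the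
    index, which the induction hypothesis must absorb. *)
Lemma big_cover_joinP X (h : nat -> T -> T) U n w :
  (\big[cover_join/[set X]]_(i < n) cover_preimage X (h i) U) w <->
  exists2 g : nat -> set T, (forall i, (i < n)%N -> U (g i)) &
    w = [set t | X t /\ forall i, (i < n)%N -> g i (h i t)].
Proof.
elim: n h w => [|n IHn] h w.
  rewrite big_ord0; split=> [->|[g _ ->]].
    by exists (fun=> setT) => //; apply/seteqP; split=> t //= [].
  by apply/seteqP; split=> t //= [].
rewrite big_ord_recl; split=> [[u [v [[u' Uu' <-] Jv ->]]]|[g Ug ->]].
  have /(IHn (fun i => h i.+1))[g Ug ->] := Jv.
  exists (fun i => if i is j.+1 then g j else u') => [[//|i /Ug//]|].
  apply/seteqP; split=> t /=.
    by move=> [[Xt ht] [_ gt]]; split=> // -[|i] // /gt.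
  by move=> [Xt gt]; split; split=> //; [exact: (gt 0%N)|move=> i /(gt i.+1)].
exists (X `&` h 0%N @^-1` g 0%N),
  [set t | X t /\ forall i, (i < n)%N -> g i.+1 (h i.+1 t)]; split.
- by exists (g 0%N) => //; exact: Ug.
- by apply/(IHn (fun i => h i.+1)); exists (fun i => g i.+1) => // i /(Ug i.+1).
- apply/seteqP; split=> t /=.
    move=> [Xt gt]; split; split=> //; first exact: (gt 0%N).
    by move=> i /(gt i.+1).
  by move=> [[Xt ht] [_ gt]]; split=> // -[|i] // /gt.
Qed.

Lemma iter_joinP X f U n w :
  iter_join X f U n w <->
  exists2 g : nat -> set T, (forall i, (i < n)%N -> U (g i)) &
    w = [set t | X t /\ forall i, (i < n)%N -> g i (iter i f t)].
Proof. exact: (big_cover_joinP X (fun i => iter i f)). Qed.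

(** Members of a subcover may be listed with repetition: the image of [D] under [g] has at most
    [#|D|] distinct elements. *)
Lemma min_subcover_le (I : finType) (D : {set I}) (g : I -> set T) X W :
  (forall i, i \in D -> W (g i)) ->
  (forall t, X t -> exists2 i, i \in D & g i t) ->
  (min_subcover X W <= (#|D|%:R : R)%:E)%E.
Proof.
move=> Wg Xg; pose e := nth set0 [seq g i | i <- enum D].
have eD k : (k < #|D|)%N -> exists2 i, i \in D & e k = g i.
  rewrite cardE => kD; have [i0 _] : exists i, i \in D.
    by move: kD; case: (enum D) (mem_enum D) => // i ? /(_ i); rewrite mem_head;
      exists i.
  exists (nth i0 (enum D) k); first by rewrite -mem_enum mem_nth.
  by rewrite /e (nth_map i0).
have [n Vn] : finite_set (e @` `I_#|D|) by exact/finite_image/finite_II.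
have nD : (n <= #|D|)%N.
  by rewrite -card_le_II -(card_le_eql Vn) card_image_le.
apply: (@le_trans _ _ (n%:R%:E)); last by rewrite lee_fin ler_nat.
apply: ereal_inf_lbound; exists n => //; exists (e @` `I_#|D|); split => //.
  by move=> _ [k /eD[i Di ->] <-]; exact: Wg.
move=> t /Xg[i Di gt]; exists (g i) => //; exists (index i (enum D)) => /=.
  by rewrite cardE index_mem mem_enum.
by rewrite /e (nth_map i) ?index_mem ?mem_enum// nth_index ?mem_enum.
Qed.

(** A finite infimum means that the set of admissible cardinalities is nonempty, and a nonempty set
    of naturals has a least element. *)
Lemma min_subcover_attained X W : (min_subcover X W < +oo :> \bar R)%E ->
  exists N (e : 'I_N -> set T), [/\ min_subcover X W = (N%:R : R)%:E,
    forall i, W (e i) & forall t, X t -> exists i, e i t].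
Proof.
move=> /ereal_inf_lt[_ [n [V Vn] <-] _].
pose P n := `[<exists V, [/\ V `<=` W, X `<=` \bigcup_(v in V) v &
  (V #= `I_n)%card]>].
have exP : exists n, P n by exists n; apply/asboolP; exists V.
case: (ex_minnP exP) => N /asboolP[V' [VW XV cV]] minN.
have /card_set_bijP[e [eV _ Ve]] : (`I_N #= V')%card by rewrite card_eq_sym.
exists N, (fun i => e i); split=> [|i|t /XV[v /Ve[i /= iN <-] et]].
- apply/eqP; rewrite eq_le; apply/andP; split.
    by apply: ereal_inf_lbound; exists N => //; exists V'.
  apply: le_ereal_inf_tmp => _ [k [V'' V''P] <-]; rewrite lee_fin ler_nat.
  by apply: minN; apply/asboolP; exists V''.
- exact/VW/eV/ltn_ord.
- by exists (Ordinal iN).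
Qed.

Lemma min_subcover_ge1 X W t : X t -> (1%E <= min_subcover X W :> \bar R)%E.
Proof.
move=> Xt; apply: le_ereal_inf_tmp => _ [[|k] [V [_ XV cV]] <-].
  have [v Vv _] := XV _ Xt.
  by move: Vv; move: cV; rewrite II0 card_eq0 => /eqP ->.
by rewrite lee_fin ler1n.
Qed.

(** Intersecting a minimal subcover of the [m]-th join with the preimage under [iter m f] of one of
    the [n]-th join gives a subcover of the [(m + n)]-th join. *)
Lemma iter_join_submul X f U m n M N :
  (forall t, X t -> X (f t)) ->
  min_subcover X (iter_join X f U m) = (M%:R : R)%:E ->
  min_subcover X (iter_join X f U n) = (N%:R : R)%:E ->
  (min_subcover X (iter_join X f U (m + n)) <= ((M * N)%:R : R)%:E)%E.
Proof.
move=> fX eM eN.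
have Xiter i t : X t -> X (iter i f t).
  by move=> Xt; elim: i => //= i; exact: fX.
have [|M' [e1 [eM' e1J Xe1]]] := @min_subcover_attained X (iter_join X f U m).
  by rewrite eM ltry.
have [|N' [e2 [eN' e2J Xe2]]] := @min_subcover_attained X (iter_join X f U n).
  by rewrite eN ltry.
have MM' : M' = M.
  by apply/eqP; rewrite -(eqr_nat R); apply/eqP/EFin_inj; rewrite -eM.
have NN' : N' = N.
  by apply/eqP; rewrite -(eqr_nat R); apply/eqP/EFin_inj; rewrite -eN.
rewrite -MM' -NN' -[M']card_ord -[N']card_ord -card_prod -cardsT.
apply: (@min_subcover_le _ _
  (fun p => e1 p.1 `&` [set t | X t /\ e2 p.2 (iter m f t)])).
  move=> [i j] _ /=; have /iter_joinP[g1 Ug1 ->] := e1J i.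
  have /iter_joinP[g2 Ug2 ->] := e2J j; apply/iter_joinP.
  exists (fun k => if (k < m)%N then g1 k else g2 (k - m)%N).
    move=> k kmn; case: ltnP => [/Ug1//|mk]; apply: Ug2.
    by rewrite ltn_subLR.
  apply/seteqP; split=> t /=.
    move=> [[Xt g1t] [_ [_ g2t]]]; split=> // k kmn; case: ltnP => [/g1t//|mk].
    by rewrite -{2}(subnK mk) iterD; apply: g2t; rewrite ltn_subLR.
  move=> [Xt gt]; split; split => //.
    by move=> k km; have := gt k (ltn_addr _ km); rewrite km.
  split=> [|k kn]; first exact: Xiter.
  have := gt (k + m)%N; rewrite addnC ltn_add2l => /(_ kn).
  by rewrite ltnNge leq_addr/= addKn addnC iterD.
move=> t Xt; have [i it] := Xe1 _ Xt; have [j jt] := Xe2 _ (Xiter m _ Xt).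
by exists (i, j).
Qed.

End Covers.

(** * Covering entropy *)

Section Fekete.
Context {R : realType}.

(** The limit is the infimum of the quotients over [n > 0]. With [k] nearly optimal and
    [n = q * k + r], subadditivity gives [u n <= q * u k + u r], and the remainder term vanishes
    after division by [n]. *)
Lemma fekete (u : nat -> R) : (forall n, 0 <= u n) ->
  (forall m n, u (m + n)%N <= u m + u n) ->
  cvgn (fun n => n%:R^-1 * u n).
Proof.
move=> u_ge0 uD.
pose S := [set n%:R^-1 * u n | n in [set n | (0 < n)%N]].
have S0 : S !=set0 by exists (1%:R^-1 * u 1%N); exists 1%N.
have Slb : has_inf S.
  by split=> //; exists 0 => _ [n _ <-]; rewrite mulr_ge0 ?invr_ge0.
have uM k q r : u (q * k + r)%N <= q%:R * u k + u r.
  elim: q => [|q IHq]; first by rewrite mul0n add0n mul0r add0r.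
  by rewrite mulSn -addnA mulrSr mulrDl; have := uD k (q * k + r)%N; lra.
apply/cvg_ex; exists (inf S); apply/cvgrPdist_le => e e0.
have e2 : 0 < e / 2 by rewrite divr_gt0.
have [_ [k /= k0 <-] uk] := inf_adherent e2 Slb.
(* The terms are nonnegative, so this sum bounds [u r] for all remainders [r < k] at once. *)
pose M := \sum_(r < k) u r.
have uM' r : (r < k)%N -> u r <= M.
  move=> rk; rewrite /M (bigD1 (Ordinal rk)) //= lerDl.
  by apply: sumr_ge0.
have M0 : 0 <= M by apply: sumr_ge0.
near=> n.
have n0 : (0 < n)%N by near: n; exact: nbhs_infty_gt.
have nR0 : 0 < n%:R :> R by rewrite ltr0n.
have kR0 : 0 < k%:R :> R by rewrite ltr0n.
have lb : inf S <= n%:R^-1 * u n.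
  by apply: ge_inf; [case: Slb|exists n].
rewrite ler0_norm ?subr_le0// opprB lerBlDl.
have un : u n <= (n %/ k)%:R * u k + M.
  rewrite {1}(divn_eq n k); apply: (le_trans (uM _ _ _)).
  by rewrite lerD2l uM'// ltn_pmod.
have nk : (n %/ k)%:R * u k <= n%:R * (k%:R^-1 * u k).
  rewrite mulrA ler_wpM2r// ler_pdivlMr// -natrM ler_nat.
  exact: leq_trunc_div.
have Mn : n%:R^-1 * M <= e / 2.
  rewrite mulrC ler_pdivrMr// -ler_pdivrMl//.
  by near: n; exact: nbhs_infty_ger.
have : n%:R^-1 * u n <= k%:R^-1 * u k + n%:R^-1 * M.
  rewrite -[k%:R^-1 * _](mulKf (lt0r_neq0 nR0)) -mulrDr.
  by rewrite ler_pM2l ?invr_gt0// (le_trans un)// lerD2r.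
move: uk Mn; lra.
Unshelve. all: by end_near. Qed.

End Fekete.

Section CoverEntropy.
Context {R : realType}.

Section OneSystem.
Context {T : topologicalType} (X : set T) (f : T -> T) (U : set (set T)).
Hypothesis X0 : X !=set0.
Hypothesis fX : forall t, X t -> X (f t).
Hypothesis finU :
  forall n, (min_subcover X (iter_join X f U n) < +oo :> \bar R)%E.

Definition join_number n : R :=
  fine (min_subcover X (iter_join X f U n) : \bar R).

Lemma join_numberE n :
  min_subcover X (iter_join X f U n) = (join_number n)%:E.
Proof.
rewrite fineK// fin_numElt finU andbT.
have [t Xt] := X0.
exact: (lt_le_trans (ltNyr 1) (min_subcover_ge1 _ Xt)).
Qed.

Lemma join_number_ge1 n : 1 <= join_number n.
Proof.
have [t Xt] := X0; rewrite -lee_fin -join_numberE.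
exact: min_subcover_ge1 Xt.
Qed.

Lemma join_numberD m n :
  join_number (m + n) <= join_number m * join_number n.
Proof.
have [M [_ [eM _ _]]] := min_subcover_attained (finU m).
have [N [_ [eN _ _]]] := min_subcover_attained (finU n).
rewrite -lee_fin -join_numberE /join_number eM eN /= -natrM.
exact: iter_join_submul.
Qed.

Lemma join_number_cvg : cvgn (fun n => n%:R^-1 * ln (join_number n)).
Proof.
have gt0 n : 0 < join_number n by rewrite (lt_le_trans _ (join_number_ge1 n)).
apply: fekete => [n|m n]; first by rewrite ln_ge0 ?join_number_ge1.
rewrite -lnM ?posrE// ler_ln ?posrE ?mulr_gt0//.
exact: join_numberD.
Qed.

Lemma cover_entropyE : cover_entropy X f U =
  (limn (fun n => n%:R^-1 * ln (join_number n)))%:E.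
Proof.
rewrite /cover_entropy -EFin_lim; last exact: join_number_cvg.
congr (limn _); apply/funext => n /=.
(* [lne] is the real logarithm only at positive reals; join numbers are at least 1. *)
rewrite join_numberE /= leNgt.
by rewrite (lt_le_trans _ (join_number_ge1 n))// EFinM.
Qed.

Lemma cover_entropy_ge0 : (0 <= cover_entropy X f U :> \bar R)%E.
Proof.
rewrite cover_entropyE lee_fin; apply: limr_ge; first exact: join_number_cvg.
by apply: nearW => n; rewrite mulr_ge0 ?invr_ge0 ?ln_ge0 ?join_number_ge1.
Qed.

End OneSystem.

(** After taking logarithms and dividing by [n], the exponent [l] becomes a factor and the constant
    [C] contributes [ln C / n], which tends to 0. *)
Lemma cover_entropy_le {T T' : topologicalType}
    (X : set T) (f : T -> T) (U : set (set T))
    (X' : set T') (f' : T' -> T') (U' : set (set T'))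
    (P : nat -> nat) (C l : nat) :
  X !=set0 -> (forall t, X t -> X (f t)) ->
  X' !=set0 -> (forall t, X' t -> X' (f' t)) ->
  (forall n, (min_subcover X' (iter_join X' f' U' n) < +oo :> \bar R)%E) ->
  (forall n, (min_subcover X (iter_join X f U n)
    <= ((C * P n ^ l)%:R : R)%:E)%E) ->
  (forall n, (((P n)%:R : R)%:E
    <= min_subcover X' (iter_join X' f' U' n))%E) ->
  (cover_entropy X f U <= (l%:R : R)%:E * cover_entropy X' f' U')%E.
Proof.
move=> X0 fX X'0 fX' finU' UP PU'.
have finU n : (min_subcover X (iter_join X f U n) < +oo :> \bar R)%E.
  by apply: (le_lt_trans (UP n)); rewrite ltry.
rewrite !cover_entropyE// -EFinM lee_fin.
set v := fun n => _ * ln (join_number X' f' U' n).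
have cv : cvgn v by exact: join_number_cvg.
pose w n : R := n%:R^-1 * ln C%:R.
have w0 : w @ \oo --> (0 : R).
  apply/cvgrPdist_le => e e0; near=> n.
  have n0 : 0 < n%:R :> R by rewrite ltr0n; near: n; exact: nbhs_infty_gt.
  rewrite sub0r normrN normrM gtr0_norm ?invr_gt0// mulrC ler_pdivrMr//.
  rewrite -ler_pdivrMl// mulrC.
  by near: n; exact: nbhs_infty_ger.
have lv : (fun n => w n + l%:R * v n) @ \oo --> 0 + l%:R * limn v.
  by apply: cvgD => //; exact: cvgMl_tmp.
rewrite -[leRHS]add0r -(cvg_lim _ lv)//.
apply: ler_lim; [exact: join_number_cvg|exact: cvgP lv|].
apply: nearW => n; rewrite /w /v mulrCA -mulrDr ler_wpM2l ?invr_ge0//.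
have gt0 : 0 < join_number X f U n.
  by rewrite (lt_le_trans ltr01)// join_number_ge1.
have gt0' : 0 < join_number X' f' U' n.
  by rewrite (lt_le_trans ltr01)// join_number_ge1.
have := UP n; rewrite join_numberE// lee_fin => UPn.
have := PU' n; rewrite join_numberE// lee_fin => PUn'.
have C0 : 0 < C%:R :> R.
  (* [C = 0] would bound by 0 a join number that is at least 1. *)
  rewrite ltr0n lt0n; apply: contraTneq UPn => ->.
  by rewrite mul0n -ltNge.
rewrite mulr_natl -lnXn// -lnM ?posrE ?exprn_gt0//.
rewrite ler_ln ?posrE ?mulr_gt0 ?exprn_gt0//.
apply: (le_trans UPn); rewrite natrM natrX.
apply: ler_wpM2l; first exact: ler0n.
by apply: lerXn2r => //; rewrite nnegrE ?ler0n// ltW.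
Unshelve. all: by end_near. Qed.

End CoverEntropy.

(** * Symbolic coding of orbit closures *)

Section Words.
Context {S : finType}.
Implicit Types (s : nat -> S).

Definition word s n m : {ffun 'I_n -> S} := [ffun i : 'I_n => s (m + i)%N].

Definition words s n : {set {ffun 'I_n -> S}} :=
  [set w | `[<exists m, w = word s n m>]].

Lemma wordP s n m m' : word s n m = word s n m' <->
  (forall i, (i < n)%N -> s (m + i)%N = s (m' + i)%N).
Proof.
split=> [/ffunP ww i ni|ss]; first by have := ww (Ordinal ni); rewrite !ffunE.
by apply/ffunP => i; rewrite !ffunE ss.
Qed.

Lemma mem_words s n m : word s n m \in words s n.
Proof. by rewrite inE; apply/asboolP; exists m. Qed.

Lemma wordsP s n w : w \in words s n -> exists m, w = word s n m.
Proof. by rewrite inE => /asboolP. Qed.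

(** Coding each word by a chosen position where it occurs is injective. All later word counts go
    through this bound. *)
Lemma card_words_le (I : finType) (D : {set I}) (code : nat -> I) s n :
  (forall m, code m \in D) ->
  (forall m m', code m = code m' -> word s n m = word s n m') ->
  (#|words s n| <= #|D|)%N.
Proof.
move=> codeD codeP.
pose rep (w : {ffun 'I_n -> S}) := xget 0%N [set m | w = word s n m].
have repP w : w \in words s n -> w = word s n (rep w).
  move=> /wordsP[m wm].
  exact: (@xgetPex _ 0%N [set m | w = word s n m] (ex_intro _ m wm)).
rewrite -(@card_in_imset _ _ (code \o rep) (words s n)).
  by apply: subset_leq_card; apply/fintype.subsetP => _ /imsetP[w _ ->] /=.
by move=> w w' /repP wE /repP w'E /codeP; rewrite -wE -w'E.
Qed.

Lemma card_wordsD s m n :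
  (#|words s (m + n)| <= #|words s m| * #|words s n|)%N.
Proof.
rewrite -cardsX.
apply: (@card_words_le _ _ (fun k => (word s m k, word s n (k + m))))
  => [k|k k'].
  by rewrite inE /= !mem_words.
move=> [/wordP km /wordP kn]; apply/wordP => i imn.
case: (ltnP i m) => [/km//|mi].
by rewrite -(subnKC mi) !addnA kn// ltn_subLR.
Qed.

End Words.

Section OrbitClosure.
Context {R : realType} {K : topologicalType} (rho : K -> K -> R).
Hypothesis rhoC : forall z z', rho z z' = rho z' z.
Hypothesis rho_triangle : forall z1 z2 z3, rho z1 z3 <= rho z1 z2 + rho z2 z3.
Hypothesis rho_gt0 : forall z z', z <> z' -> 0 < rho z z'.
Hypothesis rho_near : forall z e, 0 < e -> \forall z' \near z, rho z z' < e.
Variable y : nat -> K.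

Local Notation X := (orbit_closure y).
Local Notation orbit m := ((fun n => y (m + n)%N) : {ptws nat -> K}).

Lemma orbit_closure_orbit m : X (orbit m).
Proof.
by split=> [n|]; apply: subset_closure => /=; [exists (m + n)%N|exists m].
Qed.

Lemma iter_shift i (w : {ptws nat -> K}) n : iter i shift w n = w (i + n)%N.
Proof. by elim: i n => // i IHi n; rewrite iterS /shift IHi addSnnS. Qed.

Lemma iter_shift_orbit i m : iter i shift (orbit m) = orbit (m + i).
Proof. by apply/funext => n; rewrite iter_shift addnA. Qed.

Lemma nbhs_coord (w : {ptws nat -> K}) k (P : set K) :
  nbhs (w k) P -> nbhs w [set w' : {ptws nat -> K} | P (w' k)].
Proof. exact: (@proj_continuous nat (fun=> K) k w). Qed.

Lemma nbhs_coords (w : {ptws nat -> K}) k e : 0 < e ->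
  nbhs w [set w' : {ptws nat -> K} |
    forall i, (i < k)%N -> rho (w i) (w' i) < e].
Proof.
move=> e0; elim: k => [|k IHk].
  by apply: (@filterS _ _ (nbhs_filter w) setT); [|exact: filterT].
apply: (@filterS _ _ (nbhs_filter w) _ _ _
  (@filterI _ _ (nbhs_filter w) _ _ IHk (nbhs_coord (rho_near (w k) e0)))).
by move=> w' [/= H Hk] i; rewrite ltnS leq_eqVlt => /predU1P[->|/H].
Qed.

Lemma orbit_approx w k e : X w -> 0 < e ->
  exists m, forall i, (i < k)%N -> rho (w i) (y (m + i)%N) < e.
Proof.
by move=> [_ clw] /(nbhs_coords w k) /clw[_ [[m _ <-]]]; exists m.
Qed.

Lemma shift_continuous : continuous (@shift K).
Proof.
move=> w; have FF := fmap_filter (@shift K) (nbhs_filter w).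
apply/cvg_sup => i.
apply: (@continuous_comp_initial _ _ _ (fun f : nat -> K => f i)).
exact: (@proj_continuous nat (fun=> K) i.+1).
Qed.

Lemma shift_orbit_closure w : X w -> X (shift w).
Proof.
move=> [VCw clw]; split=> [n|B /shift_continuous/clw]; first exact: VCw.
move=> [_ [[m _ <-]] Bm]; exists (orbit m.+1); split; first by exists m.+1.
by move: Bm; congr B; apply/funext => n; rewrite /shift addSnnS.
Qed.

Hypothesis value_compact : compact (value_closure y).

Lemma orbit_closure_compact : compact X.
Proof.
apply: compact_closedI; last exact: closed_closure.
exact: (@tychonoff nat (fun=> K) (fun=> value_closure y)).
Qed.

(** The topology is only assumed to make nearby points [rho]-close; the converse comes from
    compactness. Each [w'] other than [w] differs from it at some coordinate, hence has a
    neighbourhood that small balls around [w] miss, and a near-covering argument makes the radius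
    uniform. *)
Lemma open_contains_ball w O : X w -> open O -> O w ->
  exists k, forall w', X w' ->
    (forall i, (i < k)%N -> rho (w i) (w' i) < k.+1%:R^-1) -> O w'.
Proof.
move=> Xw oO Ow.
pose P k (w' : {ptws nat -> K}) :=
  (forall i, (i < k)%N -> rho (w i) (w' i) < k.+1%:R^-1) -> O w'.
have : \forall k \near \oo, X `<=` P k.
  apply: (proj1 (compact_near_coveringP _) orbit_closure_compact) => w' Xw'.
  have [<-|/eqP ww'] := eqVneq w w'.
    exists (O, setT) => //=; last by move=> [w'' k] [/= Ow'' _] _.
    by split; [exact: open_nbhs_nbhs|exact: filterT].
  have [i wi] : exists i, w i <> w' i.
    by apply/existsNP => ww; apply: ww'; apply/funext.
  have r0 := rho_gt0 wi.
  have r2 : 0 < rho (w i) (w' i) / 2 by rewrite divr_gt0.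
  near=> w'' k => H; exfalso.
  have w'i : rho (w' i) (w'' i) < rho (w i) (w' i) / 2.
    by near: w''; exact: (nbhs_coord (rho_near (w' i) r2)).
  have ki : (i < k)%N by near: k; exact: nbhs_infty_gt.
  have kr : k.+1%:R^-1 < rho (w i) (w' i) / 2.
    by near: k; exact: near_infty_natSinv_lt (PosNum r2).
  suff : rho (w i) (w' i) < rho (w i) (w' i) by rewrite ltxx.
  have := H _ ki; have := rho_triangle (w i) (w'' i) (w' i).
  rewrite (rhoC (w'' i)) => /= rD rk; apply: (le_lt_trans rD).
  by rewrite [ltRHS]splitr ltrD// (lt_trans rk).
by case=> k _ /(_ k (leqnn k)) H; exists k => w' Xw'; exact: H.
Unshelve. all: by end_near. Qed.

Lemma lebesgue_number (U : set (set {ptws nat -> K})) : open_cover X U ->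
  exists k, forall w, X w -> exists2 u, U u & forall w', X w' ->
    (forall i, (i < k)%N -> rho (w i) (w' i) < k.+1%:R^-1) -> u w'.
Proof.
move=> [oU XU].
pose P k (w : {ptws nat -> K}) := exists2 u, U u & forall w', X w' ->
    (forall i, (i < k)%N -> rho (w i) (w' i) < k.+1%:R^-1) -> u w'.
have : \forall k \near \oo, X `<=` P k.
  apply: (proj1 (compact_near_coveringP _) orbit_closure_compact) => w Xw.
  have [u Uu uw] := XU _ Xw; have [V oV uV] := oU _ Uu.
  have Vw : V w by move: uw; rewrite uV => -[].
  have [j jP] := open_contains_ball Xw oV Vw.
  (* Half of the radius at [w] is spent on moving the centre to [w'], the other half on the ball
     around [w']. *)
  have e0 : 0 < j.+1%:R^-1 / 2 :> R by rewrite divr_gt0.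
  near=> w' k; exists u => // w'' Xw'' w'w''; rewrite uV; split => //.
  apply: jP => // i ij.
  have ww' : rho (w i) (w' i) < j.+1%:R^-1 / 2.
    by move: i ij; near: w'; exact: nbhs_coords.
  have kj : (j <= k)%N by near: k; exact: nbhs_infty_ge.
  have ke : k.+1%:R^-1 < j.+1%:R^-1 / 2 :> R.
    by near: k; exact: near_infty_natSinv_lt (PosNum e0).
  apply: (le_lt_trans (rho_triangle (w i) (w' i) (w'' i))).
  by rewrite [ltRHS]splitr ltrD// (lt_trans _ ke)// w'w''// (leq_trans ij).
by case=> k _ /(_ k (leqnn k)) H; exists k => w Xw; exact: H.
Unshelve. all: by end_near. Qed.

Context {S : finType}.
Variable s : nat -> S.

Lemma words_le_subcover k e : 0 < e ->
  (forall m m',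
    (forall i, (i < k)%N -> rho (y (m + i)%N) (y (m' + i)%N) < e) ->
    s m = s m') ->
  exists2 V, open_cover X V &
    forall n, (((#|words s n|)%:R : R)%:E
      <= min_subcover X (iter_join X shift V n))%E.
Proof.
move=> e0 ys.
(* Letters belong to times, not to points, so [Q j] only constrains orbit points, at every time that
   yields them. The interiors cover [X] because orbit points within [e / 2] of [w] on [k]
   coordinates share a letter. *)
pose Q j := [set w : {ptws nat -> K} | forall m, w = orbit m -> s m = j].
exists [set X `&` interior (Q j) | j in [set: S]].
  split=> [_ [j _ <-]|w Xw].
    by exists (interior (Q j)) => //; exact: open_interior.
  have e2 : 0 < e / 2 by rewrite divr_gt0.
  have [m0 wm0] := orbit_approx k Xw e2.
  exists (X `&` interior (Q (s m0))); first by exists (s m0).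
  split=> //; apply: (@filterS _ _ (nbhs_filter w) _ _ _ (nbhs_coords w k e2)).
  move=> w' /= ww' m w'E; apply: ys => i ik.
  apply: (le_lt_trans (rho_triangle _ (w i) _)).
  rewrite [ltRHS]splitr ltrD// ?wm0// rhoC.
  by have := ww' i ik; rewrite w'E.
move=> n; rewrite leNgt; apply/negP => lt.
have := lt_le_trans lt (leey _) => /min_subcover_attained[N [c [cN cJ Xc]]].
move: lt; rewrite cN lte_fin ltr_nat ltnNge => /negP; apply.
(* Code a position by a cover element containing its orbit point: an element of the join fixes the
   letters at [n] consecutive times. *)
have /choice[code codeP] : forall m, exists j, c j (orbit m).
  by move=> m; apply: Xc; exact: orbit_closure_orbit.
rewrite -[N]card_ord -cardsT.
apply: (card_words_le (code := code)) => // m m' mm'; apply/wordP => i ni.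
have /iter_joinP[g Vg cE] := cJ (code m).
have [j _ gE] := Vg i ni.
have mem k0 : c (code m) (orbit k0) -> s (k0 + i)%N = j.
  rewrite cE => -[_ /(_ i ni)]; rewrite -gE => -[_ /interior_subset].
  by apply; rewrite iter_shift_orbit.
by rewrite !mem// mm'.
Qed.

Lemma subcover_le_words :
  (forall e, 0 < e -> exists C (c : nat -> 'I_C), forall n m m',
    c m = c m' -> (forall i, (i < n)%N -> s (m + i)%N = s (m' + i)%N) ->
    forall i, (i < n)%N -> rho (y (m + i)%N) (y (m' + i)%N) < e) ->
  forall U, open_cover X U -> exists C, forall n,
    (min_subcover X (iter_join X shift U n)
      <= ((C * #|words s n|)%:R : R)%:E)%E.
Proof.
move=> sy U oU; have [k kP] := lebesgue_number oU.
have /choice[u uP] : forall m, exists u, U u /\ forall w', X w' ->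
    (forall i, (i < k)%N -> rho (y (m + i)%N) (w' i) < k.+1%:R^-1) -> u w'.
  by move=> m; have [v Uv vP] := kP _ (orbit_closure_orbit m); exists v.
have e0 : 0 < k.+1%:R^-1 / 2 :> R by rewrite divr_gt0.
have [C [c cP]] := sy _ e0.
(* The Lebesgue number inspects [k] coordinates, so following a point for [n] steps takes words of
   length [n + k]; the extra letters cost the factor [#|words s k|]. *)
exists (C * #|words s k|)%N => n.
(* Only pairs of a colour and a word that occur at some position are kept, so each has a
   representative [rep p] whose orbit supplies the cover elements. *)
pose D := [set p : 'I_C * {ffun 'I_(n + k) -> S} |
  `[<exists m, p = (c m, word s (n + k) m)>]]%SET.
pose rep (p : 'I_C * {ffun 'I_(n + k) -> S}) :=
  xget 0%N [set m | p = (c m, word s (n + k) m)].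
have repP p : p \in D -> p = (c (rep p), word s (n + k) (rep p)).
  rewrite inE => /asboolP[m pm].
  exact: (@xgetPex _ 0%N [set m | p = (c m, word s (n + k) m)]
    (ex_intro _ m pm)).
have DC : (#|D| <= C * #|words s k| * #|words s n|)%N.
  rewrite -mulnA [(#|words s k| * _)%N]mulnC.
  apply: (@leq_trans (C * #|words s (n + k)|)); last first.
    by rewrite leq_mul2l card_wordsD orbT.
  have -> : (C * #|words s (n + k)| =
      #|finset.setX [set: 'I_C]%SET (words s (n + k))|)%N.
    by rewrite cardsX cardsT card_ord.
  apply: subset_leq_card.
  apply/fintype.subsetP => p /repP ->; rewrite inE /= inE; exact: mem_words.
apply: (@le_trans _ _ (#|D|%:R%:E)); last by rewrite lee_fin ler_nat.
apply: (@min_subcover_le R _ _ D (fun p => [set t : {ptws nat -> K} | X t /\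
    forall i, (i < n)%N -> u (rep p + i)%N (iter i shift t)])) => [p _|t Xt].
  apply/iter_joinP; exists (fun i => u (rep p + i)%N) => // i _.
  by have [] := uP (rep p + i)%N.
have [m tm] := orbit_approx (n + k) Xt e0.
pose p := (c m, word s (n + k) m).
have pD : p \in D by rewrite inE; apply/asboolP; exists m.
exists p => //; split=> // i ni; have [_] := uP (rep p + i)%N; apply.
  by elim: i {ni} => //= i; exact: shift_orbit_closure.
have /pair_equal_spec[cm /wordP wm] := repP _ pD.
move=> j jk; rewrite iter_shift rhoC.
have ij : (i + j < n + k)%N by rewrite -addnS leq_add// ltnW.
apply: (le_lt_trans (rho_triangle _ (y (m + (i + j))%N) _)).
rewrite [ltRHS]splitr ltrD ?tm//.
by rewrite -addnA; apply: cP cm wm _ ij.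
Qed.

End OrbitClosure.

(** * Comparison of entropies through word counts *)

Section SymbolicModel.
Context {R : realType}.

Definition symbolic_model {K : topologicalType} {S : finType}
    (y : nat -> K) (s : nat -> S) :=
  let X := orbit_closure y in
  (exists2 V, open_cover X V & forall n,
    (((#|words s n|)%:R : R)%:E
      <= min_subcover X (iter_join X shift V n))%E)
  /\ (forall U, open_cover X U -> exists C, forall n,
    (min_subcover X (iter_join X shift U n)
      <= ((C * #|words s n|)%:R : R)%:E)%E).

Lemma orbit_closure_neq0 {K : topologicalType} (y : nat -> K) :
  orbit_closure y !=set0.
Proof. by exists (fun n => y (0 + n)%N); exact: orbit_closure_orbit. Qed.

Context {K K' : topologicalType} {S S' : finType}.
Variables (y : nat -> K) (s : nat -> S) (y' : nat -> K') (s' : nat -> S').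

Lemma AE_ge0 : symbolic_model y s -> (0 <= AE R y)%E.
Proof.
move=> [[V oV _] /(_ V oV)[C fin]].
apply: (@le_trans _ _ (cover_entropy (orbit_closure y) shift V)).
  apply: cover_entropy_ge0.
  - exact: orbit_closure_neq0.
  - exact: shift_orbit_closure.
  - by move=> n; apply: (le_lt_trans (fin n)); rewrite ltry.
by apply: ereal_sup_ubound; exists V.
Qed.

(** Every cover for [y] is compared with the single cover [V] for [y'] whose joins need at least as
    many elements as there are words of [s']. *)
Lemma AE_le (C l : nat) : symbolic_model y s -> symbolic_model y' s' ->
  (forall n, #|words s n| <= C * #|words s' n| ^ l)%N ->
  (AE R y <= (l%:R : R)%:E * AE R y')%E.
Proof.
move=> [_ ys] [[V oV sV] ys'] ss'; apply: ge_ereal_sup => _ [U oU <-].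
have [B UB] := ys _ oU; have [B' VB'] := ys' _ oV.
apply: (@le_trans _ _
  ((l%:R : R)%:E * cover_entropy (orbit_closure y') shift V)%E).
  apply: (cover_entropy_le (C := B * C) (P := fun n => #|words s' n|)) => //.
  - exact: orbit_closure_neq0.
  - exact: shift_orbit_closure.
  - exact: orbit_closure_neq0.
  - exact: shift_orbit_closure.
  - by move=> n; apply: (le_lt_trans (VB' n)); rewrite ltry.
  - move=> n; apply: (le_trans (UB n)); rewrite lee_fin ler_nat -mulnA.
    by rewrite leq_mul2l ss' orbT.
rewrite lee_wpmul2l ?lee_fin//.
by apply: ereal_sup_ubound; exists V.
Qed.

End SymbolicModel.

(** * The circle *)

Section CircleDistance.
Context {R : realType}.
Local Open Scope quotient_scope.
Implicit Types (s t : R) (z : circle R).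

(** Distance to the nearest integer, obtained by rounding. *)
Definition dist_int t : R := `|t - (Num.floor (t + 2^-1))%:~R|.

Lemma dist_int_le t (n : int) : dist_int t <= `|t - n%:~R|.
Proof.
rewrite /dist_int; set r := Num.floor _.
have [<-//|nr] := eqVneq r n.
have tr : `|t - r%:~R| <= 2^-1.
  have /andP[rl ru] := floor_itv (t + 2^-1); rewrite -/r intrD in rl ru.
  by rewrite ler_norml; apply/andP; split; lra.
have rn : 1 <= `|r%:~R - n%:~R| :> R.
  by rewrite -intrB -intr_norm ler1z -gtz0_ge1 normr_gt0 subr_eq0.
have : `|r%:~R - n%:~R| <= `|r%:~R - t| + `|t - n%:~R| by exact: ler_distD.
by rewrite (distrC r%:~R t); lra.
Qed.

Lemma dist_int_le_norm t : dist_int t <= `|t|.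
Proof. by have := dist_int_le t 0; rewrite subr0. Qed.

Lemma dist_intD s t : dist_int (s + t) <= dist_int s + dist_int t.
Proof.
set m := Num.floor (s + 2^-1); set n := Num.floor (t + 2^-1).
apply: (le_trans (dist_int_le _ (m + n))).
by rewrite intrD opprD addrACA ler_normD.
Qed.

Lemma dist_intN t : dist_int (- t) = dist_int t.
Proof.
have le u : dist_int (- u) <= dist_int u.
  apply: (le_trans (dist_int_le _ (- Num.floor (u + 2^-1)))).
  by rewrite intrN -opprD normrN.
by apply/eqP; rewrite eq_le le/= -{1}[t]opprK le.
Qed.

Lemma dist_int_shift t (n : int) : dist_int (t + n%:~R) = dist_int t.
Proof.
have le u (k : int) : dist_int (u + k%:~R) <= dist_int u.
  apply: (le_trans (dist_int_le _ (Num.floor (u + 2^-1) + k))).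
  by rewrite intrD opprD addrACA subrr addr0.
apply/eqP; rewrite eq_le le/= -{1}[t](addrK n%:~R) -intrN; exact: le.
Qed.

Lemma dist_int_gt0 t : t \isn't a Num.int -> 0 < dist_int t.
Proof.
move=> tN; rewrite normr_gt0 subr_eq0; apply: contraNneq tN => ->.
exact: intr_int.
Qed.

Definition circle_dist z z' : R := dist_int (repr z - repr z').

Lemma circle_dist_mod1 s t : circle_dist (mod1 s) (mod1 t) = dist_int (s - t).
Proof.
have reprE (u : R) : exists n : int, repr (mod1 u) = u + n%:~R.
  have /eqmodP : \pi_{eq_quot (@eqmod1 R)} (repr (mod1 u)) =
      \pi_{eq_quot (@eqmod1 R)} u.
    exact: (@reprK _ {eq_quot (@eqmod1 R)}).
  by move=> /intrP[n nE]; exists n; rewrite -nE addrC subrK.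
rewrite /circle_dist; have [m ->] := reprE s; have [n ->] := reprE t.
by rewrite opprD addrACA -intrN -intrD dist_int_shift.
Qed.

Lemma circle_distC z z' : circle_dist z z' = circle_dist z' z.
Proof. by rewrite /circle_dist -dist_intN opprB. Qed.

Lemma circle_dist_triangle z1 z2 z3 :
  circle_dist z1 z3 <= circle_dist z1 z2 + circle_dist z2 z3.
Proof. by rewrite /circle_dist -(subrKA (repr z2)) dist_intD. Qed.

Lemma circle_dist_gt0 z z' : z <> z' -> 0 < circle_dist z z'.
Proof.
move=> zz'; apply: dist_int_gt0; apply/negP => zint; apply: zz'.
rewrite -[z]reprK -[z']reprK; exact/eqmodP.
Qed.

Lemma circle_dist_near z e : 0 < e -> \forall z' \near z, circle_dist z z' < e.
Proof.
move=> e0; apply: open_nbhs_nbhs; split; last first.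
  by rewrite /= /circle_dist subrr (le_lt_trans (dist_int_le_norm _))// normr0.
have mod1K : mod1 (repr z) = z by exact: (@reprK _ {eq_quot (@eqmod1 R)}).
(* Open in the quotient topology means, by definition, having an open preimage in the line. *)
change (open (@mod1 R @^-1` [set z' | circle_dist z z' < e])).
have -> : @mod1 R @^-1` [set z' | circle_dist z z' < e] =
    [set t : R | dist_int (repr z - t) < e].
  have dE t : circle_dist z (mod1 t) = dist_int (repr z - t).
    by rewrite -[in LHS]mod1K circle_dist_mod1.
  by apply/seteqP; split=> t /=; rewrite dE.
rewrite openE => t /= te; apply/nbhs_ballP.
exists (e - dist_int (repr z - t)) => /=; first by rewrite subr_gt0.
move=> t'; rewrite /ball /= => tt'; rewrite -(subrKA t).
apply: (le_lt_trans (dist_intD _ _)).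
by rewrite -ltrBrDl (le_lt_trans (dist_int_le_norm _)).
Qed.

Lemma circle_compact : compact [set: circle R].
Proof.
have -> : [set: circle R] = @mod1 R @` `[0, 1].
  apply/seteqP; split=> // z _; exists (repr z - (Num.floor (repr z))%:~R).
    by have /andP[] := floor_itv (repr z); rewrite /= in_itv /= intrD; lra.
  rewrite -[RHS]reprK; apply/eqmodP; rewrite /= /eqmod1.
  by rewrite addrAC subrr sub0r rpredN intr_int.
apply: continuous_compact; last exact: segment_compact.
exact: (continuous_subspaceT (@pi_continuous _ _)).
Qed.

End CircleDistance.

(** * Dilations *)

Section DilationModel.
Context {R : realType}.
Variables (a : nat -> nat) (l : nat).
Hypothesis a_lt : forall n, (a n < a n.+1)%N.
Hypothesis a_gap : forall n, (a n.+1 - a n <= l)%N.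

Definition gap_word n : 'I_l.+1 := inord (a n.+1 - a n).

Lemma gap_word_inj m m' : gap_word m = gap_word m' ->
  (a m.+1 - a m = a m'.+1 - a m')%N.
Proof. by move=> /(congr1 val); rewrite /gap_word /= !inordK ?ltnS ?a_gap. Qed.

(** Equal gap words give equal displacements from the starting points; the additive form avoids
    truncated subtraction. *)
Lemma gap_word_sum m m' n :
  (forall i, (i < n)%N -> gap_word (m + i) = gap_word (m' + i)) ->
  forall i, (i <= n)%N -> (a (m + i) + a m' = a (m' + i) + a m)%N.
Proof.
move=> mm'; elim=> [_|i IHi ni]; first by rewrite !addn0 addnC.
have := IHi (ltnW ni); have := gap_word_inj (mm' _ ni).
have := a_lt (m + i); have := a_lt (m' + i); rewrite !addnS; lia.
Qed.

Lemma irrational_dist_int_gt0 (x : R) j : irrational x -> (0 < j)%N ->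
  0 < dist_int (j%:R * x).
Proof.
move=> irr j0; apply: dist_int_gt0; apply/negP => /intrP[k kE]; apply: irr.
apply/rationalP; exists k, j; rewrite -kE mulrC mulKf// pnatr_eq0.
by rewrite -lt0n.
Qed.

Lemma irrational_dist_int_lb (x : R) n : irrational x ->
  exists2 e, 0 < e & forall j, (0 < j <= n)%N -> e <= dist_int (j%:R * x).
Proof.
move=> irr; elim: n => [|n [e e0 eP]].
  by exists 1 => // j; rewrite leqn0 => /andP[/lt0n_neq0/negbTE ->].
exists (Num.min e (dist_int (n.+1%:R * x))).
  by rewrite lt_min e0 irrational_dist_int_gt0.
move=> j /andP[j0]; rewrite leq_eqVlt => /predU1P[->|jn].
  by rewrite ge_min lexx orbT.
by rewrite ge_min eP// j0.
Qed.

Lemma dilation_model (x : R) : irrational x ->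
  symbolic_model (R := R) (dilation_mod1 (fun n => (a n)%:Z) x) gap_word.
Proof.
move=> irr.
have cpt : compact (value_closure (dilation_mod1 (fun n => (a n)%:Z) x)).
  by apply: (subclosed_compact _ circle_compact) => //; exact: closed_closure.
have dE m m' : circle_dist (dilation_mod1 (fun n => (a n)%:Z) x m)
    (dilation_mod1 (fun n => (a n)%:Z) x m') =
    dist_int ((a m)%:R * x - (a m')%:R * x).
  by rewrite /dilation_mod1 circle_dist_mod1.
split.
  have [e e0 eP] := irrational_dist_int_lb l irr.
  have e2 : 0 < e / 2 by rewrite divr_gt0.
  (* Two coordinates suffice: the difference of consecutive terms is the gap times [x]. Distinct
     gaps are at most [l], so they would give a nonzero multiple [j * x] with [j <= l] closer than
     [e] to an integer. *)
  apply: (words_le_subcover circle_distC circle_dist_triangle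
    circle_dist_near (k := 2) e2) => m m' mm'.
  have := mm' 0%N isT; have := mm' 1%N isT; rewrite !dE !addn0 !addn1.
  move=> H1 H0.
  have : dist_int (((a m.+1)%:R * x - (a m'.+1)%:R * x)
      - ((a m)%:R * x - (a m')%:R * x)) < e.
    by rewrite (le_lt_trans (dist_intD _ _))// dist_intN [ltRHS]splitr ltrD.
  have -> : (a m.+1)%:R * x - (a m'.+1)%:R * x
        - ((a m)%:R * x - (a m')%:R * x) =
      (a m.+1 - a m)%:R * x - (a m'.+1 - a m')%:R * x.
    by rewrite !natrB ?(ltnW (a_lt _))//; ring.
  rewrite /gap_word; have := a_gap m; have := a_gap m'.
  set d := (a m.+1 - a m)%N; set d' := (a m'.+1 - a m')%N => dl' dl.
  rewrite ltNge; have [dd'|dd'|->//] := ltngtP d d'; case/negP.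
    rewrite -dist_intN opprB -mulrBl -natrB ?(ltnW dd')//.
    by apply: eP; rewrite subn_gt0 dd' (leq_trans _ dl')// leq_subr.
  rewrite -mulrBl -natrB ?(ltnW dd')//.
  by apply: eP; rewrite subn_gt0 dd' (leq_trans _ dl)// leq_subr.
apply: (subcover_le_words circle_distC circle_dist_triangle
  circle_dist_gt0 circle_dist_near cpt) => e e0.
(* The circle is cut into [C] arcs of length [1 / C < e]; the colour of [m] is the arc containing
   the fractional part [fr m]. *)
pose C := (Num.truncn e^-1).+1.
have Ce : C%:R^-1 < e.
  by rewrite invf_plt ?posrE// truncnS_gt.
pose fr m := (a m)%:R * x - (Num.floor ((a m)%:R * x))%:~R.
have frP m : 0 <= fr m < 1.
  have /andP[] := floor_itv ((a m)%:R * x); rewrite intrD /fr => *.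
  by apply/andP; split; lra.
have CfrP m : 0 <= C%:R * fr m by rewrite mulr_ge0//; case/andP: (frP m).
exists C, (fun m => inord (Num.truncn (C%:R * fr m))) => n m m' cmm' smm' i ni.
rewrite dE.
(* With a common gap word the two orbit segments differ by a fixed rotation, so the initial distance
   persists. *)
have -> : (a (m + i))%:R * x - (a (m' + i))%:R * x =
    (a m)%:R * x - (a m')%:R * x.
  have /(congr1 (fun k => k%:R : R)) := gap_word_sum smm' (ltnW ni).
  by rewrite !natrD => H; rewrite -!mulrBl; congr (_ * _); lra.
have -> : (a m)%:R * x - (a m')%:R * x = fr m - fr m'
   + (Num.floor ((a m)%:R * x) - Num.floor ((a m')%:R * x))%:~R.
  by rewrite intrB /fr; ring.
rewrite dist_int_shift (le_lt_trans (dist_int_le_norm _))//.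
rewrite (le_lt_trans _ Ce)//.
have fC k : (Num.truncn (C%:R * fr k) < C)%N.
  rewrite truncn_lt_nat// -[ltRHS]mulr1 ltr_pM2l ?ltr0n//.
  by case/andP: (frP k).
have : Num.truncn (C%:R * fr m) = Num.truncn (C%:R * fr m').
  by move/(congr1 val): cmm'; rewrite /= !inordK.
have /andP[] := truncn_itv (CfrP m); have /andP[] := truncn_itv (CfrP m').
move=> + + + + tt'; rewrite tt' -natr1 => H1 H2 H3 H4.
rewrite -[leRHS]mul1r ler_pdivlMr ?ltr0n// -[C%:R]ger0_norm// -normrM.
by rewrite mulrC mulrBr ler_norml; apply/andP; split; lra.
Qed.

End DilationModel.

(** * The indicator sequence *)

Section IndicatorModel.
Context {R : realType}.
Implicit Types (z : Cplx R).

(** The modulus takes its values in [R[i]]; its real part is the same number in [R]. *)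
Definition cplx_dist z z' : R := complex.Re (`|z - z'| : R[i]).

Lemma cplx_distC z z' : cplx_dist z z' = cplx_dist z' z.
Proof. by rewrite /cplx_dist distrC. Qed.

Lemma cplx_dist_triangle z1 z2 z3 :
  cplx_dist z1 z3 <= cplx_dist z1 z2 + cplx_dist z2 z3.
Proof.
have := ler_distD z2 z1 z3; rewrite lecE => /andP[_].
by rewrite /cplx_dist raddfD.
Qed.

Lemma cplx_dist_gt0 z z' : z <> z' -> 0 < cplx_dist z z'.
Proof.
move=> /eqP; rewrite -subr_eq0 -normr_gt0 ltcE => /andP[_].
exact.
Qed.

Lemma cplx_dist_near z e : 0 < e -> \forall z' \near z, cplx_dist z z' < e.
Proof.
move=> e0; apply/nbhs_ballP; exists (e%:C)%C; first by rewrite /= ltcR.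
by move=> z' /=; rewrite -ball_normE /= ltcE => /andP[_].
Qed.

Lemma indicator_model (A : set nat) :
  symbolic_model (R := R) (\1_A : nat -> Cplx R) (fun n => n \in A).
Proof.
have oneE n : (\1_A : nat -> Cplx R) n = (n \in A)%:R by [].
have cpt : compact (value_closure (\1_A : nat -> Cplx R)).
  have fin : finite_set (range (\1_A : nat -> Cplx R)).
    apply: (@sub_finite_set _ _ [set 0; 1]); last exact: finite_set2.
    by move=> _ [n _ <-]; rewrite oneE; case: (n \in A); [right|left].
  have : closed (range (\1_A : nat -> Cplx R)).
    apply: (proj1 accessible_finite_set_closed _ _ fin).
    exact/hausdorff_accessible/norm_hausdorff.
  by rewrite /value_closure => /closure_id <-; exact: finite_compact.
split.
  apply: (words_le_subcover cplx_distC cplx_dist_triangle cplx_dist_near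
    (k := 1) ltr01) => m m' /(_ 0%N isT).
  rewrite !addn0 !oneE /cplx_dist.
  case: (m \in A); case: (m' \in A) => //.
    by rewrite subr0 normr1 ltxx.
  by rewrite sub0r normrN normr1 ltxx.
apply: (subcover_le_words cplx_distC cplx_dist_triangle
  cplx_dist_gt0 cplx_dist_near cpt) => e e0.
(* One colour is enough, since the letter determines the value. *)
exists 1%N, (fun=> ord0) => n m m' _ ss i ni.
by rewrite !oneE ss// /cplx_dist subrr normr0.
Qed.

End IndicatorModel.

(** * Comparison of word counts *)

Section WordComparison.
Variables (A : set nat) (a : nat -> nat) (l : nat).
Hypothesis a_lt : forall n, (a n < a n.+1)%N.
Hypothesis a_gap : forall n, (a n.+1 - a n <= l)%N.
Hypothesis a_range : range a = A.

Local Notation ind := (fun n : nat => n \in A).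

Let indP n : reflect (exists j, n = a j) (n \in A).
Proof.
apply: (iffP idP); rewrite -a_range; first by move=> /set_mem[j _ <-]; exists j.
by move=> [j ->]; apply/mem_set; exists j.
Qed.

Let leq_a i j : (i <= j)%N -> (a i <= a j)%N.
Proof.
move=> /subnKC <-; elim: (j - i)%N => [|k IHk]; rewrite ?addn0//.
by rewrite addnS (leq_trans IHk)// ltnW.
Qed.

Let a_ge m i : (a m + i <= a (m + i))%N.
Proof.
elim: i => [|i IHi]; first by rewrite !addn0.
by rewrite !addnS (leq_ltn_trans IHi).
Qed.

Let a_le m i : (a (m + i) <= a m + l * i)%N.
Proof.
elim: i => [|i IHi]; first by rewrite muln0 !addn0.
by rewrite addnS mulnS; have := a_gap (m + i); lia.
Qed.

(** The word at [m] is coded by the phase, which is the distance from [m] to the first element [a t]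
    of [A] with [m <= a t], and by the gap word at [t]. The phase is at most [l] if [t > 0] and at
    most [a 0] if [t = 0]. *)
Lemma card_indicator_words n :
  (#|words ind n| <= (maxn l (a 0)).+1 * #|words (gap_word a l) n|)%N.
Proof.
have /choice[t tP] : forall m, exists t, [/\ (m <= a t)%N,
    (a t - m <= maxn l (a 0))%N & forall u, (u < t)%N -> (a u < m)%N].
  move=> m; have ext : exists t, (m <= a t)%N.
    by exists m; apply: leq_trans (a_ge 0 m); rewrite leq_addl.
  case: (ex_minnP ext) => t mt tmin; exists t; split=> //.
    case: t mt tmin => [|t] mt tmin; first by rewrite leq_max leq_subr orbT.
    have : (a t < m)%N by rewrite ltnNge; apply/negP => /tmin; rewrite ltnn.
    by have := a_gap t; rewrite leq_max; lia.
  by move=> u ut; rewrite ltnNge; apply/negP => /tmin; rewrite leqNgt ut.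
have -> : ((maxn l (a 0)).+1 * #|words (gap_word a l) n| =
    #|finset.setX [set: 'I_(maxn l (a 0)).+1]%SET (words (gap_word a l) n)|)%N.
  by rewrite cardsX cardsT card_ord.
apply: (card_words_le (code := fun m =>
  (inord (a (t m) - m), word (gap_word a l) n (t m)))) => [m|m m'].
  by rewrite inE /= inE; exact: mem_words.
move=> /pair_equal_spec[/(congr1 val) /= rr /wordP ww].
have {}rr : (a (t m) - m = a (t m') - m')%N.
  by move: rr; rewrite !inordK// ltnS; [case: (tP m')|case: (tP m)].
have impl k k' i : (a (t k) - k = a (t k') - k')%N ->
    (forall i, (i < n)%N ->
      gap_word a l (t k + i) = gap_word a l (t k' + i)) ->
    (i < n)%N -> (k + i)%N \in A -> (k' + i)%N \in A.
  move=> rk wk ni /indP[j kij]; apply/indP.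
  have [kt _ ktmin] := tP k; have [k't' _ _] := tP k'.
  have tj : (t k <= j)%N.
    by rewrite leqNgt; apply/negP => /ktmin; rewrite -kij ltnNge leq_addr.
  have jE := subnKC tj; set q := (j - t k)%N in jE.
  (* Every gap is at least 1, so an element of [A] inside the window is reached within the [n]
     recorded gaps. *)
  have qn : (q <= n)%N.
    by have := a_ge (t k) q; rewrite jE -kij; lia.
  exists (t k' + q)%N; have := gap_word_sum a_lt a_gap wk qn.
  by rewrite jE -kij; lia.
apply/wordP => i ni; apply/idP/idP; first exact: impl.
by apply: impl => // j /ww.
Qed.

(** From [a m], the next [n] elements of [A] lie within distance [l * n], so a window of [l * n + 1]
    letters starting there shows them all. *)
Lemma card_gap_words n :
  (#|words (gap_word a l) n| <= #|words ind (l * n + 1)|)%N.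
Proof.
apply: (card_words_le (code := fun m => word ind (l * n + 1) (a m)))
  => [m|m m'].
  exact: mem_words.
move=> /wordP mm'.
(* The translate of [a (k + i.+1)] lies in [A] beyond [a (k' + i)], hence not before
   [a (k' + i.+1)]. Applying this in both directions gives equality. *)
have next k k' i : (i < n)%N ->
    (forall i, (i < l * n + 1)%N ->
      ((a k + i)%N \in A) = ((a k' + i)%N \in A)) ->
    (a (k + i) + a k' = a (k' + i) + a k)%N ->
    (a (k' + i.+1) + a k <= a (k + i.+1) + a k')%N.
  move=> ni kk' IHi.
  have ki := a_le k i.+1.
  have ki' : (a k <= a (k + i.+1))%N by rewrite leq_a// leq_addr.
  have lin : (l * i.+1 <= l * n)%N by rewrite leq_mul2l ni orbT.
  have : (a k' + (a (k + i.+1) - a k))%N \in A.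
    rewrite -kk'; last by lia.
    by apply/indP; exists (k + i.+1)%N; rewrite subnKC.
  move=> /indP[j jE].
  have : (k' + i < j)%N.
    rewrite ltnNge; apply/negP => /leq_a.
    by have := a_lt (k + i); rewrite -addnS; lia.
  by rewrite -addnS => /leq_a; lia.
have aE i : (i <= n)%N -> (a (m + i) + a m' = a (m' + i) + a m)%N.
  elim: i => [|i IHi] ni; first by rewrite !addn0 addnC.
  apply/eqP; rewrite eqn_leq; apply/andP; split.
    by apply: next => // [j /mm'//|]; rewrite IHi// ltnW.
  by apply: next => //; rewrite IHi// ltnW.
apply/wordP => i ni; rewrite /gap_word; congr inord.
have := aE _ ni; have := aE _ (ltnW ni); rewrite !addnS.
by have := a_lt (m + i); have := a_lt (m' + i); lia.
Qed.

End WordComparison.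

(** * Powers of word counts, null set of rationals, and conclusion *)

Lemma card_wordsM {S : finType} (s : nat -> S) k n :
  (#|words s (k * n)| <= #|words s n| ^ k)%N.
Proof.
elim: k => [|k IHk].
  by rewrite mul0n (leq_trans (max_card _))// card_ffun card_ord expn0.
rewrite mulSn (leq_trans (card_wordsD _ _ _))// expnS leq_mul2l IHk.
by rewrite orbT.
Qed.

Lemma rational_negligible (R : realType) :
  (@lebesgue_measure R).-negligible (@rational R).
Proof.
have cQ : countable (@rational R).
  exact: (card_le_trans (card_image_le _ _) (countableP _)).
exists rational; split=> //; last exact: countable_lebesgue_measure0.
by apply: countable_measurable => // t; exact: measurable_set1.
Qed.

Theorem theorem6p8 (R : realType) (A : set nat) (a : nat -> nat) (L : R)
    (A_infinite : infinite_set A)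
    (a_increasing : forall m n : nat, (m < n)%N -> (a m < a n)%N)
    (a_enumerates : range a = A)
    (L_gt0 : 0 < L)
    (gap_le : (ereal_sup
       (range (fun n : nat => (`|(a n.+1)%:R - (a n)%:R : R|)%:E)) <= L%:E)%E) :
  (forall x : R, irrational x ->
     (AE R (\1_A : nat -> Cplx R)
        <= AE R (dilation_mod1 (fun n => (a n)%:Z) x))%E /\
     (AE R (dilation_mod1 (fun n => (a n)%:Z) x)
        <= L%:E * AE R (\1_A : nat -> Cplx R))%E) /\
  (AE R (\1_A : nat -> Cplx R) = 0%E <->
     centered R (fun n => (a n)%:Z) /\
     has_dual_entropy R (fun n => (a n)%:Z) 0%E).
Proof.
have a_lt n : (a n < a n.+1)%N by exact: a_increasing.
(* Gaps are integers, so a real bound [L] can be replaced by its integer part, which serves as [l]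
   throughout. *)
have a_gap n : (a n.+1 - a n <= Num.truncn L)%N.
  rewrite (truncn_ge_nat _ (ltW L_gt0)) natrB ?(ltnW (a_lt n))//.
  apply: (le_trans (ler_norm _)); rewrite -lee_fin; apply: le_trans gap_le.
  by apply: ereal_sup_ubound; exists n.
have modA := indicator_model (R := R) A.
have A_ge0 := AE_ge0 modA.
have bounds (x : R) : irrational x ->
    (AE R (\1_A : nat -> Cplx R)
      <= AE R (dilation_mod1 (fun n => (a n)%:Z) x))%E /\
    (AE R (dilation_mod1 (fun n => (a n)%:Z) x)
      <= L%:E * AE R (\1_A : nat -> Cplx R))%E.
  move=> irr; have moda := dilation_model a_lt a_gap irr; split.
    rewrite -[leRHS]mul1e.
    apply: (AE_le (C := (maxn (Num.truncn L) (a 0)).+1) (l := 1) modA moda)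
      => n.
    by rewrite expn1; exact: card_indicator_words.
  apply: (@le_trans _ _ ((Num.truncn L)%:R%:E * AE R (\1_A : nat -> Cplx R))%E).
    (* The constant pays for the last letter of the window of length [l * n + 1]; the rest splits
       into [l] words of length [n]. *)
    apply: (AE_le (C := #|words (fun n => n \in A) 1|) moda modA) => n.
    apply: (leq_trans (card_gap_words a_lt a_gap a_enumerates n)).
    rewrite (leq_trans (card_wordsD _ _ _))// mulnC leq_mul2l.
    by rewrite card_wordsM orbT.
  by rewrite lee_wpmul2r// lee_fin truncn_le ltW.
split=> //; split=> [A0|[_ [_ dual]]].
  have dual0 : has_dual_entropy R (fun n => (a n)%:Z) 0%E.
    split=> //; apply: negligibleS (rational_negligible R) => x /= nz.
    apply: contrapT => irr; apply: nz; move: (bounds x irr).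
    by rewrite A0 mule0 => -[le1 le2]; apply/eqP; rewrite eq_le le1 le2.
  by split=> //; exists 0%E.
(* The line has positive measure, so properties that hold almost everywhere have a common witness:
   an irrational [x] with [AE] zero, to which the lower bound applies. *)
have PF : ProperFilter (almost_everywhere (@lebesgue_measure R)).
  apply: ae_properfilter_algebraOfSetsType.
  have lt01 : (0 < lebesgue_measure (`[0%R, 1%R] : set R))%E.
    by rewrite lebesgue_measure_itv /= lte_fin ltr01 oppr0 adde0 lte_fin.
  by apply: (lt_le_trans lt01); apply: le_measure; rewrite ?inE.
have irrational_ae : almost_everywhere lebesgue_measure (@irrational R).
  by rewrite /almost_everywhere /irrational setCK; exact: rational_negligible.
have [x [irr dx]] := filter_ex (filterI irrational_ae dual).
by apply/eqP; rewrite eq_le A_ge0 andbT -dx; exact: (bounds x irr).1.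
Qed.
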